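(* Let $m\geq 1$ be an integer, let $p_1,\ldots,p_m>0$ be real numbers with $p_1+\cdots+p_m=1$, let $L\geq 1.12$, and let $g_1\geq g_2\geq\ldots\geq g_m>0$ be real numbers. Then there exist real numbers $\{k_j^i : 1\leq j<i\leq m\}$ (here $i$ is an upper index, not an exponent) such that $$k_j^i\geq 0 \ \text{ for all } 1\leq j<i\leq m, \qquad \sum_{j<i}k_j^i\, p_j \leq 1 \ \text{ for all } 1\leq i\leq m,$$ and $$\sum_{i\leq m}\frac{p_i}{g_i}\exp\Bigl\{\sum_{j<i}\Bigl(k_j^i\log\frac{g_i}{g_j} + \frac{1}{L}\psi(k_j^i)\Bigr)p_j\Bigr\}\leq\frac{1}{p_1 g_1+\ldots+p_m g_m}.$$
   Context: The function $\psi:\mathbb{R}\to\mathbb{R}$ is defined by $\psi(x)=x^2/4$ for $x\leq 2$ and $\psi(x)=x-1$ for $x\geq 2$. The symbol $\log$ denotes the natural logarithm. Sums $\sum_{j<i}$ run over $1\leq j<i$ and are zero when $i=1$. *)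

(* Defs.v *)
From mathcomp Require Import all_boot all_order all_algebra.
From mathcomp Require Import all_classical all_reals all_analysis.

Set Implicit Arguments.
Unset Strict Implicit.
Unset Printing Implicit Defensive.

Import Order.TTheory GRing.Theory Num.Theory.
Local Open Scope ring_scope.

(* The two clauses agree at x = 2. *)
Definition psi (R : realType) (x : R) : R :=
  if x <= 2 then x ^+ 2 / 4 else x - 1.

(* Main.v *)
Require Import Defs.
From mathcomp Require Import all_boot all_order all_algebra.
From mathcomp Require Import all_classical all_reals all_analysis.
From mathcomp Require Import ring lra.

(** Put [x i := - ln (g i)], a nondecreasing sequence of levels, so that
    [ln (g i / g j) = x j - x i].  For fixed [i] the exponent is smallest when
    [k i j] maximizes [k * (x i - x j) - psi k / L] under the budget
    [\sum_j k i j * p j <= 1].  Without the budget, and as long as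
    [x i - x j <= 1 / L], the maximizer is [k = 2 L (x i - x j)], which saves
    [L (x i - x j)^2].  Thus a point at level [z] spends [load z] of its budget
    and saves [saving z], with [load] the derivative of [saving].

    This choice stops being admissible at a level [t] ([load_threshold]) at
    which either the budget is exhausted, or the distance to the lowest level
    [x ord0] reaches [1 / L].  In the second case [psi] has become affine with
    slope [1], so the rest of the budget can be put on the index [ord0] at no net
    cost.  In both cases the budget is fully spent at [t]; the points above [t]
    keep these weights, and raising them further increases the saving at rate
    exactly [1].  Hence ([frozen_weights]) the exponent of every point, corrected
    by [- ln (g i)], is [z - saving z] at the truncated level [z = min (x i) t].

    It remains to show ([profile_le])
      [(\sum_i p i * e^(y i - saving (y i))) * (\sum_i p i * e^(- y i)) <= 1]
    with [y i = min (x i) t].  Truncate instead at a level [z] that grows from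
    [x ord0] to [t].  At [z = x ord0] there is equality.  In infinitesimal form,
    the increase of the first factor is controlled by that of the inverse of the
    second one as soon as
      [(1 - load z) * e^(- saving z) * (\sum_i p i * e^((z - x i)_+))^2 <= 1];
    this holds because [1 - load <= e^(- load)] and, thanks to [L >= 1.12],
    [e^r <= 1 + L r + L r^2 / 2] on [[0, 1 / L]] ([expR_le_quadratic]), which
    bounds the square by [e^(load + saving)].  Between two consecutive levels
    [load] is affine, so [saving] is integrated exactly by the trapezoidal rule
    ([saving_trapezoid]), and the same argument goes through for the whole step
    without differentiating, with a [sinh] inequality ([expR_sinh_le]) in place
    of [1 - load <= e^(- load)]. *)

Set Implicit Arguments.
Unset Strict Implicit.
Unset Printing Implicit Defensive.

Import Order.TTheory GRing.Theory Num.Theory.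
Import numFieldNormedType.Exports.
Local Open Scope ring_scope.

(** * Two inequalities for the exponential *)

Lemma ge0_is_derive_le (R : realType) (f f' : R -> R) (a b : R) :
  (forall x : R, is_derive x 1 f (f' x)) ->
  (forall x, a < x -> x < b -> 0 <= f' x) ->
  a <= b -> f a <= f b.
Proof.
move=> df f'0 ab; apply: (@ger0_derive1_ndecr _ f a b) => // x.
- by rewrite in_itv/= => /andP[ax xb]; rewrite derive1E derive_val f'0.
- apply: continuous_subspaceT => {}x.
  by apply/differentiable_continuous/derivable1_diffP; case: (df x).
Qed.

(** The constant [1.12] is, up to rounding, the least [L] for which this holds
    at the endpoint [r = 1 / L]; at [r = 25 / 28 = 1 / 1.12] the margin is about
    [0.004]. *)
Lemma expR_le_quadratic (R : realType) (L r : R) :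
  112 / 100 <= L -> 0 <= r -> r <= 1 / L ->
  expR r <= 1 + L * r + L * r ^+ 2 / 2.
Proof.
move=> hL r0 rL.
have L0 : 0 < L by lra.
have rc : r <= 25 / 28.
  by apply: le_trans rL _; rewrite ler_pdivrMr//; lra.
(* [P] is the Taylor polynomial of degree 4 with its last coefficient multiplied
   by [1.29]: enough for [P' >= P] on [[0, 25 / 28]], so that [P x * e^(-x)]
   is nondecreasing there, while [P] still fits below the quadratic. *)
pose P (x : R) : R := 1 + x + x ^+ 2 / 2 + x ^+ 3 / 6 + 129 / 2400 * x ^+ 4.
have EP : expR r <= P r.
  pose F (x : R) : R := P x * expR (- x).
  have: F 0 <= F r.
    pose F' (x : R) : R := (29 / 600 * x ^+ 3 - 129 / 2400 * x ^+ 4) * expR (- x).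
    apply: (@ge0_is_derive_le _ F F' 0 r); last exact: r0.
      move=> x; rewrite /F /F' /P.
      apply: is_derive_eq.
      by rewrite /GRing.scale/=; field.
    move=> x x0 xr; apply: mulr_ge0; last exact: expR_ge0.
    have -> : 29 / 600 * x ^+ 3 - 129 / 2400 * x ^+ 4
      = x ^+ 3 * (29 / 600 - 129 / 2400 * x) by ring.
    by apply: mulr_ge0; [apply: exprn_ge0; lra | lra].
  rewrite /F /P !expr0n/= oppr0 expR0 expRN ler_pdivlMr ?expR_gt0//.
  by rewrite !(mul0r, mulr0, addr0, mulr1, mul1r).
apply: le_trans EP _.
have: 112 / 100 * (r + r ^+ 2 / 2) <= L * (r + r ^+ 2 / 2).
  by apply: ler_wpM2r => //; rewrite addr_ge0// divr_ge0// exprn_ge0.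
suff: P r <= 1 + 112 / 100 * (r + r ^+ 2 / 2) by lra.
rewrite {}/P.
have h2 : r ^+ 2 <= 25 / 28 * r by rewrite expr2 ler_wpM2r.
have h3 : r ^+ 3 <= 25 / 28 * (25 / 28 * r).
  by rewrite exprS ler_pM// exprn_ge0.
have : 0 <= r * (12 / 100 + 6 / 100 * r - r ^+ 2 / 6 - 129 / 2400 * r ^+ 3).
  apply: mulr_ge0; first exact: r0.
  by clear - h2 h3 r0 rc; lra.
by lra.
Qed.

(** [sinh (t * v) <= t * sinh v] for [0 <= t <= 1] by convexity of [sinh] on the
    nonnegative reals, and [e^a * (1 - a) <= 1]. *)
Lemma expR_sinh_le (R : realType) (a v : R) : 0 <= a -> a <= 1 -> 0 <= v ->
  expR a * (expR ((1 - a) * v) - expR (- ((1 - a) * v))) <= expR v - expR (- v).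
Proof.
move=> a0 a1 v0; set t := 1 - a.
have t0 : 0 <= t by rewrite /t; lra.
have t1 : t <= 1 by rewrite /t; lra.
have S : expR (t * v) - expR (- (t * v)) <= t * (expR v - expR (- v)).
  rewrite -subr_ge0.
  pose F (x : R) : R :=
    t * (expR x - expR (- x)) - (expR (t * x) - expR (- (t * x))).
  have : F 0 <= F v.
    apply: (@ge0_is_derive_le _ F
      (fun x => t * ((expR x - expR (t * x)) * (1 - expR (- x - t * x))))) => //.
      move=> x; rewrite /F; apply: is_derive_eq.
      rewrite /GRing.scale/= expRD.
      have e1 : expR x * expR (- x) = 1 by rewrite -expRD subrr expR0.
      have e2 : expR (t * x) * expR (- (t * x)) = 1 by rewrite -expRD subrr expR0.
      transitivity (t * (expR x - expR (t * x)
         - (expR x * expR (- x)) * expR (- (t * x))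
         + expR (- x) * (expR (t * x) * expR (- (t * x))))).
        by rewrite e1 e2; ring.
      by ring.
    (* The derivative of [F] is [2 t (cosh x - cosh (t x))], in factored form. *)
    move=> x x0 xv; apply: mulr_ge0 => //; apply: mulr_ge0; rewrite subr_ge0.
      by rewrite ler_expR; nra.
    by rewrite expR_le1; nra.
  by rewrite /F mulr0 oppr0 subrr mulr0 subrr.
have H : expR a * t <= 1.
  have := expR_ge1Dx (- a); rewrite -/t expRN => ht.
  by rewrite mulrC -ler_pdivlMr ?expR_gt0// mul1r.
apply: le_trans (_ : expR a * (t * (expR v - expR (- v))) <= _).
  by rewrite ler_pM2l ?expR_gt0.
by rewrite mulrA ler_piMl// subr_ge0 ler_expR; lra.
Qed.

(** * Budget and saving of quadratic weights *)

(** Budget [\sum_i k i * p i] spent by a point at level [z] under the weights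
    [k i = 2 L (z - x i)_+]. *)
Definition load (R : realType) (I : finType) (p x : I -> R) (L z : R) : R :=
  \sum_i 2 * L * Num.max 0 (z - x i) * p i.

(** Amount by which these same weights lower the exponent:
    [k * r - psi k / L = L r^2] for [k = 2 L r <= 2]. *)
Definition saving (R : realType) (I : finType) (p x : I -> R) (L z : R) : R :=
  \sum_i L * Num.max 0 (z - x i) ^+ 2 * p i.

Lemma load_ge0 (R : realType) (I : finType) (p x : I -> R) (L z : R) :
  (forall i, 0 <= p i) -> 0 <= L -> 0 <= load p x L z.
Proof.
move=> p0 L0; apply: sumr_ge0 => i _.
by rewrite !mulr_ge0// le_max lexx.
Qed.

Lemma load_le (R : realType) (I : finType) (p x : I -> R) (L y z : R) :
  (forall i, 0 <= p i) -> 0 <= L -> y <= z -> load p x L y <= load p x L z.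
Proof.
move=> p0 L0 yz; apply: ler_sum => i _.
by rewrite ler_wpM2r// ler_wpM2l ?mulr_ge0// ge_max !le_max lexx/= lerD2r yz orbT.
Qed.

(** [saving] is quadratic and [load] is its affine derivative on an interval
    without levels in its interior. *)
Lemma saving_trapezoid (R : realType) (I : finType) (p x : I -> R) (L a b : R) :
  (forall i, x i <= a \/ b <= x i) -> a <= b ->
  saving p x L b - saving p x L a =
    (load p x L a + load p x L b) / 2 * (b - a).
Proof.
move=> knot ab; rewrite -sumrB -big_split/= !mulr_suml.
apply: eq_bigr => i _; case: (knot i) => xi.
  by rewrite !max_r; [field | lra | lra].
by rewrite !max_l; [ring | lra | lra].
Qed.

(** Averaging [e^r <= 1 + L r + L r^2 / 2] over [r = (z - x i)_+] produces
    [1 + (load z + saving z) / 2]. *)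
Lemma sum_expRN_min_le (R : realType) (I : finType) (p x : I -> R) (L z : R) :
  112 / 100 <= L -> (forall i, 0 <= p i) -> \sum_i p i = 1 ->
  (forall i, z - x i <= 1 / L) ->
  \sum_i p i * expR (- Num.min (x i) z)
    <= expR ((load p x L z + saving p x L z) / 2 - z).
Proof.
move=> hL p0 p1 zx.
have L0 : 0 < L by lra.
have E i : - Num.min (x i) z = Num.max 0 (z - x i) - z.
  by case: (leP (x i) z) => ?; [rewrite max_r; lra | rewrite max_l; lra].
rewrite expRD; under eq_bigr do rewrite E expRD mulrA.
rewrite -mulr_suml ler_pM2r ?expR_gt0//.
apply: le_trans (expR_ge1Dx _).
rewrite -[X in X + _]p1 -big_split/= mulr_suml -big_split/=; apply: ler_sum => i _.
have r0 : 0 <= Num.max 0 (z - x i) by rewrite le_max lexx.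
have rL : Num.max 0 (z - x i) <= 1 / L by rewrite ge_max zx divr_ge0// ltW.
have := expR_le_quadratic hL r0 rL => /(ler_wpM2l (p0 i)).
by move=> h; apply: le_trans h _; rewrite le_eqVlt; apply/predU1P; left; field.
Qed.

(** Only the points above [a] move, all together, when the truncation level goes
    from [a] to [b]; with [q] their mass, [S] and [D] the two sums and
    [h z := z - saving z], one has [S b - S a = q (e^(h b) - e^(h a))] and
    [D a - D b = q (e^(- a) - e^(- b))].  Hence [S a * D a <= 1] propagates to [b]
    once [(e^(h b) - e^(h a)) * D a * D b <= e^(- a) - e^(- b)], that is, once
    [S] grows no more than [1 / D]. *)
Lemma profile_step (R : realType) (I : finType) (p x : I -> R) (L a b : R) :
  112 / 100 <= L -> (forall i, 0 < p i) -> \sum_i p i = 1 ->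
  (forall i, b - x i <= 1 / L) -> load p x L b <= 1 ->
  (forall i, x i <= a \/ b <= x i) -> a <= b ->
  (\sum_i p i * expR (Num.min (x i) a - saving p x L (Num.min (x i) a))) *
    (\sum_i p i * expR (- Num.min (x i) a)) <= 1 ->
  (\sum_i p i * expR (Num.min (x i) b - saving p x L (Num.min (x i) b))) *
    (\sum_i p i * expR (- Num.min (x i) b)) <= 1.
Proof.
move=> hL p0 p1 bx Ab knot ab.
have L0 : 0 <= L by lra.
have p0' i : 0 <= p i by rewrite ltW.
pose h z := z - saving p x L z.
have diff (f : R -> R) : \sum_i p i * f (Num.min (x i) b)
    = \sum_i p i * f (Num.min (x i) a) + (\sum_(i | a < x i) p i) * (f b - f a).
  rewrite [X in _ = _ + X * _]big_mkcond/= mulr_suml -big_split/=.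
  apply: eq_bigr => i _; case: (leP (x i) a) => xa.
    by rewrite min_l ?(le_trans xa)// mul0r addr0.
  case: (knot i) => [xa'|bxi]; first by rewrite ltNge xa' in xa.
  by rewrite min_r//; ring.
rewrite (diff (fun z => expR (h z))) -/(h _).
have := diff (fun z => expR (- z)).
set q := \sum_(i | a < x i) p i.
have q0 : 0 <= q by apply: sumr_ge0.
have ax i : a - x i <= 1 / L by apply: le_trans (bx i); rewrite lerD2r.
have Da := sum_expRN_min_le hL p0' p1 ax.
have Db := sum_expRN_min_le hL p0' p1 bx.
move: Da Db.
have D0 z : 0 < \sum_i p i * expR (- Num.min (x i) z).
  have e0 i : 0 <= p i * expR (- Num.min (x i) z) by rewrite mulr_ge0// expR_ge0.
  rewrite lt_neqAle sumr_ge0// andbT eq_sym psumr_neq0//.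
  apply/hasP; case: (pickP (xpredT : pred I)) => [i _|none].
    by exists i; rewrite ?mem_index_enum//= mulr_gt0// expR_gt0.
  by move: p1; rewrite big_pred0// => /esym/eqP; rewrite oner_eq0.
move: (D0 a) (D0 b).
set Da := \sum_i p i * expR (- Num.min (x i) a).
set Db := \sum_i p i * expR (- Num.min (x i) b).
set Sa := \sum_i _.
move=> Da0 Db0 hDa hDb eD SD.
(* [h b - h a = (1 - al) (b - a)], with [al] the mean of the two loads. *)
have tz := saving_trapezoid p L knot ab.
set al := (load p x L a + load p x L b) / 2 in tz.
have al0 : 0 <= al.
  by rewrite divr_ge0// addr_ge0// load_ge0.
have al1 : al <= 1 by rewrite /al; have := load_le x p0' L0 ab; lra.
have key : (expR (h b) - expR (h a)) * (Da * Db) <= expR (- a) - expR (- b).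
  have hh : 0 <= expR (h b) - expR (h a).
    rewrite subr_ge0 ler_expR /h.
    suff : 0 <= (1 - al) * (b - a) by rewrite mulrBl -tz; lra.
    by rewrite mulr_ge0; lra.
  apply: le_trans (_ : (expR (h b) - expR (h a)) *
      (expR ((load p x L a + saving p x L a) / 2 - a) *
       expR ((load p x L b + saving p x L b) / 2 - b)) <= _).
    by apply: ler_wpM2l => //; apply: ler_pM => //; exact: ltW.
  (* Multiplied by [e^(- (a + b) / 2)], the inequality [expR_sinh_le] at
     [v = (b - a) / 2] is the required one. *)
  have := expR_sinh_le al0 al1 (_ : 0 <= (b - a) / 2).
  rewrite divr_ge0 ?subr_ge0// => /(_ isT).
  move=> /(ler_wpM2l (expR_ge0 (- (a + b) / 2))).
  rewrite !mulrBr -!expRD !mulrBl -!expRD.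
  move=> H; apply: le_trans (le_trans H _).
    apply: lerB; rewrite ler_expR /h /al; move: tz; rewrite /al; lra.
  by apply: lerB; rewrite ler_expR; lra.
rewrite -(ler_pM2r Da0) mul1r.
have : Sa * Da * Db <= Db by rewrite ler_piMl// ltW.
have := ler_wpM2l q0 key.
have -> : Db = Da + q * (expR (- b) - expR (- a)) by [].
nra.
Qed.

(** * Raising the truncation level *)

(** At truncation level [x ord0] all points coincide and the product is [1];
    the level is then raised through the values [min (x k) t]. *)
Lemma profile_le (R : realType) (n : nat) (p x : 'I_n.+1 -> R) (L t : R) :
  112 / 100 <= L -> (forall i, 0 < p i) -> \sum_i p i = 1 ->
  (forall i j : 'I_n.+1, (i <= j)%N -> x i <= x j) ->
  x ord0 <= t -> t - x ord0 <= 1 / L -> load p x L t <= 1 ->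
  (\sum_i p i * expR (Num.min (x i) t - saving p x L (Num.min (x i) t))) *
    (\sum_i p i * expR (- Num.min (x i) t)) <= 1.
Proof.
move=> hL p0 p1 xmono xt tx At.
have L0 : 0 <= L by lra.
have p0' i : 0 <= p i by rewrite ltW.
have tx' i : t - x i <= 1 / L.
  by apply: le_trans tx; rewrite lerB ?xmono.
have H k : (k <= n)%N ->
    let y := Num.min (x (inord k)) t in
    (\sum_i p i * expR (Num.min (x i) y - saving p x L (Num.min (x i) y))) *
      (\sum_i p i * expR (- Num.min (x i) y)) <= 1.
  elim: k => [_|k IH kn] /=.
    have -> : inord 0 = ord0 :> 'I_n.+1 by apply/val_inj; rewrite /= inordK.
    rewrite (min_l xt); under eq_bigr do rewrite min_r ?xmono//.
    under [X in _ * X]eq_bigr do rewrite min_r ?xmono//.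
    rewrite -!mulr_suml p1 !mul1r -expRD.
    have -> : saving p x L (x ord0) = 0.
      rewrite /saving big1// => i _.
      by rewrite max_l ?subr_le0 ?xmono// expr0n/= mulr0 mul0r.
    by rewrite subr0 subrr expR0.
  apply: (profile_step hL p0 p1 _ _ _ _ (IH (ltnW kn))).
  - by move=> i; apply: le_trans (tx' i); rewrite lerD2r ge_min lexx orbT.
  - by apply: le_trans At; apply: load_le => //; rewrite ge_min lexx orbT.
  - move=> i; case: (leqP i k) => ik.
      have xk : x i <= x (inord k) by rewrite xmono// inordK// ltnW.
      case: (leP (x i) t) => xit; [left; by rewrite le_min xk|right].
      by rewrite ge_min (ltW xit) orbT.
    by right; rewrite ge_min xmono// inordK.
  - by rewrite le_min !ge_min lexx orbT andbT xmono// !inordK// ltnW.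
apply: (profile_step hL p0 p1 tx' At _ _ (H n (leqnn n))).
  move=> i; case: (leP (x i) t) => xit; [left|by right; rewrite ltW].
  by rewrite le_min xit andbT xmono// inordK// -ltnS.
by rewrite ge_min lexx orbT.
Qed.

(** * Choice of the weights *)

(** Level beyond which the weights [2 L (z - x j)_+] must be replaced: there the
    budget is exhausted or [psi] leaves its quadratic range. *)
Lemma load_threshold (R : realType) (n : nat) (p x : 'I_n.+1 -> R) (L : R) :
  0 < L -> (forall i, x ord0 <= x i) ->
  exists t, [/\ x ord0 <= t, t - x ord0 <= 1 / L, load p x L t <= 1
    & load p x L t = 1 \/ t = x ord0 + 1 / L].
Proof.
move=> L0 x0.
set b := x ord0 + 1 / L.
have ab : x ord0 <= b by rewrite lerDl divr_ge0// ltW.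
have [Ab|Ab] := leP (load p x L b) 1.
  by exists b; split=> //; [rewrite /b addrC addKr | right].
have A0 : load p x L (x ord0) = 0.
  by rewrite /load big1// => i _; rewrite max_l ?subr_le0// mulr0 mul0r.
have cA : continuous (load p x L).
  apply: (continuous_big (P := xpredT)) => [|i _ z]; first exact: add_continuous.
  apply: cvgMr_tmp; apply: cvgMl_tmp.
  apply: (@continuous_max _ _ (fun=> 0) (fun w : R => w - x i)).
    exact: cvg_cst.
  by apply: cvgB; [exact: cvg_id|exact: cvg_cst].
have [||t] := @IVT _ (load p x L) (x ord0) b 1 ab.
- exact: continuous_subspaceT.
- by rewrite A0 ge_min ler01 le_max (ltW Ab) orbT.
by rewrite in_itv/= => /andP[? ?] At; exists t; split; rewrite ?At ?lerBlDl//; left.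
Qed.

(** Below [t] the weights are the unconstrained optimal ones; above [t] they are
    those of a point at level [t], with the unspent budget [1 - load t] given to
    the index [ord0].  This last transfer happens only if [t = x ord0 + 1 / L];
    it starts from the weight [2], where [psi] begins to have slope [1], so it
    gains exactly what it costs.  A point above [t] has weights of total mass
    [1], which turns the remaining height [x i - t] into an equal saving. *)
Lemma frozen_weights (R : realType) (n : nat) (p x : 'I_n.+1 -> R) (L t : R) :
  0 < L -> (forall i, 0 < p i) ->
  (forall i j : 'I_n.+1, (i <= j)%N -> x i <= x j) ->
  x ord0 <= t -> t - x ord0 <= 1 / L -> load p x L t <= 1 ->
  load p x L t = 1 \/ t = x ord0 + 1 / L ->
  exists k : 'I_n.+1 -> 'I_n.+1 -> R,
    [/\ forall i j, 0 <= k i j,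
        forall i : 'I_n.+1, \sum_(j < n.+1 | (j < i)%N) k i j * p j <= 1
      & forall i : 'I_n.+1, \sum_(j < n.+1 | (j < i)%N)
            (k i j * (x j - x i) + 1 / L * psi (k i j)) * p j
          = Num.min (x i) t - saving p x L (Num.min (x i) t) - x i].
Proof.
move=> L0 p0 xmono xt tx' At tP.
have L0' : 0 <= L := ltW L0.
have p0' i : 0 <= p i := ltW (p0 i).
pose y i : R := Num.min (x i) t.
pose r i j : R := Num.max 0 (y i - x j).
pose s : R := (1 - load p x L t) / p ord0.
pose k i j : R := 2 * L * r i j + (if (t < x i) && (j == ord0) then s else 0).
have s0 : 0 <= s by rewrite divr_ge0// subr_ge0.
have r0 i j : 0 <= r i j by rewrite le_max lexx.
have rL i j : r i j <= 1 / L.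
  rewrite ge_max divr_ge0//=; apply: le_trans tx'.
  by rewrite lerB// ?xmono// ge_min lexx orbT.
have r_ge (i j : 'I_n.+1) : (i <= j)%N -> r i j = 0.
  by move=> ij; rewrite /r max_l// subr_le0 ge_min xmono.
have k_ge (i j : 'I_n.+1) : (i <= j)%N -> k i j = 0.
  move=> ij; rewrite /k r_ge// mulr0 add0r; case: ifP => // /andP[ti /eqP j0].
  move: ij; rewrite j0 leqn0 => /eqP i0; move: ti.
  by rewrite (_ : i = ord0) ?ltNge ?xt//; apply/val_inj.
have k0 i j : 0 <= k i j.
  by rewrite addr_ge0 ?mulr_ge0//; case: ifP.
have sumk i : \sum_j k i j * p j
    = load p x L (y i) + (if t < x i then 1 - load p x L t else 0).
  under eq_bigr do rewrite mulrDl.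
  rewrite big_split/=; congr (_ + _).
  rewrite (bigD1 ord0)//= eqxx andbT big1 => [|j /negbTE ->]; last first.
    by rewrite andbF mul0r.
  by rewrite addr0; case: ifP; rewrite ?mul0r// /s divfK// gt_eqF.
have restrict (i : 'I_n.+1) (F : 'I_n.+1 -> R) :
    (forall j : 'I_n.+1, (i <= j)%N -> F j = 0) ->
    \sum_(j < n.+1 | (j < i)%N) F j = \sum_j F j.
  move=> F0; rewrite [RHS](bigID (fun j : 'I_n.+1 => (j < i)%N))/=.
  by rewrite [X in _ + X]big1 ?addr0// => j; rewrite -leqNgt => /F0.
(* The height above the truncation level is separated from the saving, which
   gives one formula below and above [t], for [ord0] and for the other indices. *)
have cost (i j : 'I_n.+1) : (j < i)%N ->
    k i j * (x j - x i) + 1 / L * psi (k i j)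
    = - (L * r i j ^+ 2) - k i j * (x i - y i).
  move=> ji.
  have rk2 : 2 * L * r i j <= 2.
    have := rL i j; rewrite ler_pdivlMr// => rL1.
    by rewrite -mulrA ler_piMr// mulrC.
  have [/and3P[ti /eqP j0 sN]|Nslack] := boolP [&& t < x i, j == ord0 & s != 0].
    have tE : t = x ord0 + 1 / L.
      by case: tP => // At1; move: sN; rewrite /s At1 subrr mul0r eqxx.
    have yE : y i = t by rewrite /y min_r// ltW.
    have rE : r i j = 1 / L.
      by rewrite /r yE j0 tE addrC addKr max_r// divr_ge0.
    have kE : k i j = 2 + s.
      by rewrite /k rE ti j0 eqxx/=; congr (_ + _); field; rewrite gt_eqF.
    have sgt : 0 < s by rewrite lt_neqAle eq_sym sN.
    rewrite /psi kE leNgt ltrDl sgt/= rE yE j0 tE.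
    by field; rewrite gt_eqF.
  have kE : k i j = 2 * L * r i j.
    rewrite /k; move: Nslack; case: (t < x i) => /=; last by rewrite addr0.
    by case: (j == ord0) => [/negPn/eqP ->|_]; rewrite addr0.
  rewrite /psi kE rk2.
  have [yx|yx] := leP (y i) (x j).
    have -> : r i j = 0 by rewrite /r max_l// subr_le0.
    by field; rewrite gt_eqF.
  have rE : r i j = y i - x j by rewrite /r max_r// subr_ge0 ltW.
  by rewrite rE; field; rewrite gt_eqF.
exists k; split=> [i j|i|i]; first exact: k0.
- rewrite (restrict i (fun j => k i j * p j)) => [|j ij].
    rewrite sumk; case: ltP => ti.
      by rewrite /y min_r ?(ltW ti)// addrC subrK.
    rewrite addr0; apply: le_trans At; apply: load_le => //.
    by rewrite ge_min lexx orbT.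
  by rewrite k_ge// mul0r.
- transitivity (\sum_(j < n.+1 | (j < i)%N)
      (- (L * r i j ^+ 2) - k i j * (x i - y i)) * p j).
    by apply: eq_bigr => j ji; rewrite cost.
  rewrite (restrict i
    (fun j => (- (L * r i j ^+ 2) - k i j * (x i - y i)) * p j)); last first.
    by move=> j ij; rewrite r_ge// k_ge// expr0n/= !(mulr0, mul0r, oppr0, subr0).
  transitivity (- saving p x L (y i) - (\sum_j k i j * p j) * (x i - y i)).
    rewrite mulr_suml /saving -!sumrN -big_split/=; apply: eq_bigr => j _.
    by rewrite -/(r i j); ring.
  rewrite sumk; case: ltP => ti.
    by rewrite /y min_r ?(ltW ti)//; ring.
  by rewrite /y min_l//; ring.
Qed.

Theorem lemma1 (R : realType) (m : nat) (p g : 'I_m -> R) (L : R)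
  (hm : (1 <= m)%N)
  (hp : forall i : 'I_m, 0 < p i)
  (hp1 : \sum_(i < m) p i = 1)
  (hL : 112 / 100 <= L)
  (hg : forall i : 'I_m, 0 < g i)
  (hgm : forall i j : 'I_m, (i <= j)%N -> g j <= g i) :
  exists k : 'I_m -> 'I_m -> R,
    [/\ forall i j : 'I_m, (j < i)%N -> 0 <= k i j,
        forall i : 'I_m, \sum_(j < m | (j < i)%N) k i j * p j <= 1
      & \sum_(i < m) p i / g i *
          expR (\sum_(j < m | (j < i)%N)
                  (k i j * ln (g i / g j) + 1 / L * psi (k i j)) * p j)
        <= 1 / \sum_(i < m) p i * g i].
Proof.
case: m p g hm hp hp1 hg hgm => // n p g _ p0 p1 g0 gmono.
have L0 : 0 < L by lra.
pose x i := - ln (g i).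
have gE i : g i = expR (- x i) by rewrite /x opprK lnK ?posrE.
have xmono (i j : 'I_n.+1) : (i <= j)%N -> x i <= x j.
  by move=> /gmono gij; rewrite lerN2 ler_ln ?posrE.
have [t [xt tx At tP]] := load_threshold p L0 (fun i => xmono ord0 i (leq0n i)).
have [k [k0 k1 kE]] := frozen_weights L0 p0 xmono xt tx At tP.
exists k; split=> // {k0 k1}.
have lnE i j : ln (g i / g j) = x j - x i.
  by rewrite ln_div ?posrE// /x opprK addrC.
have expo (i : 'I_n.+1) : p i / g i * expR (\sum_(j < n.+1 | (j < i)%N)
      (k i j * ln (g i / g j) + 1 / L * psi (k i j)) * p j)
    = p i * expR (Num.min (x i) t - saving p x L (Num.min (x i) t)).
  under eq_bigr do rewrite lnE.
  by rewrite kE gE -expRN opprK -mulrA -expRD addrC subrK.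
under eq_bigr do rewrite expo.
rewrite ler_pdivlMr; last first.
  rewrite (bigD1 ord0)//= ltr_pwDl ?mulr_gt0// sumr_ge0// => i _.
  by rewrite mulr_ge0// ltW.
apply: le_trans (profile_le hL p0 p1 xmono xt tx At).
apply: ler_wpM2l.
  by apply: sumr_ge0 => i _; rewrite mulr_ge0 ?expR_ge0// ltW.
apply: ler_sum => i _.
by rewrite ler_pM2l// gE ler_expR lerN2 ge_min lexx.
Qed.
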